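(* Let $X$ be a connected manifold with corners of codimension $d\le 2$. Then $H_*^{\mathrm{pcn}}(X)$ is a free abelian group.
   Context: Manifold with corners: a Hausdorff space $X$ contained in a smooth manifold $\tilde X$ of the same dimension, with finitely many connected boundary hyperfaces $H_1,\dots,H_N$ and defining functions $r_1,\dots,r_N\in C^\infty(\tilde X)$, such that $X=\bigcap_j\{r_j\ge 0\}$, $H_j=X\cap\{r_j=0\}$, and for every subset $J$ of indices the $dr_j$, $j\in J$, are linearly independent at every point of $\bigcap_{j\in J}\{r_j=0\}$. An open face of codimension $p$ is a connected component of the set of points of $X$ at which exactly $p$ of the $r_j$ vanish; $F_p$ is the set of these faces. The codimension $d$ of $X$ is the largest $p$ with $F_p\neq\emptyset$. Conormal homology: put $e_j=dr_j$. If $f\in F_p$ lies in $H_I=H_{i_1}\cap\dots\cap H_{i_p}$, $I=(i_1<\dots<i_p)$, the conormal bundle $N(f)$ has the global basis $(e_i)_{i\in I}$ and its orientations are $\pm e_I$, $e_I=e_{i_1}\wedge\dots\wedge e_{i_p}$. $C_p(X)$ is the free $\mathbb Z$-module generated by the symbols $f\otimes\varepsilon$, $f\in F_p$, $\varepsilon$ an orientation of $N(f)$, with $f\otimes(-\varepsilon)=-(f\otimes\varepsilon)$. Contraction: $e_i\lrcorner e_I=0$ if $i\notin I$, and $e_i\lrcorner e_I=(-1)^{j-1}e_{I\setminus\{i\}}$ if $i$ is the $j$-th coordinate of $I$. The differential $\delta_p:C_p(X)\to C_{p-1}(X)$ is $\delta_p(f\otimes\varepsilon)=\sum_{g\in F_{p-1},\,f\subset\overline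 g}g\otimes e_{i_{(g,f)}}\lrcorner\varepsilon$, where $i_{(g,f)}$ is the index of the defining function whose vanishing defines $f$ in $\overline g$. $H^{\mathrm{cn}}_p(X)=H_p(C_*(X),\delta_* )$, $H_0^{\mathrm{pcn}}(X)=\bigoplus_{p\ge0}H^{\mathrm{cn}}_{2p}(X)$, $H_1^{\mathrm{pcn}}(X)=\bigoplus_{p\ge0}H^{\mathrm{cn}}_{2p+1}(X)$. *)

(* Defs.v *)
From HB Require Import structures.
From mathcomp Require Import all_boot all_order all_algebra.
From mathcomp Require Import all_classical all_reals all_analysis.
From mathcomp.multinomials Require Import freeg.

Set Implicit Arguments.
Unset Strict Implicit.
Unset Printing Implicit Defensive.

Import Order.TTheory GRing.Theory Num.Theory.
Import numFieldNormedType.Exports.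

Local Open Scope classical_set_scope.
Local Open Scope ring_scope.

Section Smooth.
Context {R : realType} {n : nat} {W : normedModType R}.
Implicit Types (U : set 'rV[R]_n) (f : 'rV[R]_n -> W).

(* On an open set [U]: all iterated directional derivatives of order at most
   [k] exist and are continuous. *)
Fixpoint Ck (k : nat) U f : Prop :=
  {in U, continuous f} /\
  if k is k'.+1 then
    forall v, (forall x, U x -> derivable f x v) /\ Ck k' U ('D_v f)
  else True.

Definition smooth_on U f := forall k, Ck k U f.

End Smooth.

(* [chart_inv] is only meaningful on the image of the domain; its values
   elsewhere are irrelevant. *)
Record chart (R : realType) (n : nat) (M : topologicalType) := Chart {
  chart_dom : set M;
  chart_map :> M -> 'rV[R]_n;
  chart_inv : 'rV[R]_n -> M;
  chart_dom_open : open chart_dom;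
  chart_img_open : open (chart_map @` chart_dom);
  chart_mapK : {in chart_dom, cancel chart_map chart_inv};
  chart_map_continuous : {in chart_dom, continuous chart_map};
  chart_inv_continuous : {in chart_map @` chart_dom, continuous chart_inv}
}.

Definition smooth_transition (R : realType) (n : nat) (M : topologicalType)
    (phi psi : chart R n M) : Prop :=
  smooth_on (phi @` (chart_dom phi `&` chart_dom psi))
            (psi \o chart_inv phi).

Record smoothManifold (R : realType) (n : nat) := SmoothManifold {
  manifold_sort :> topologicalType;
  manifold_hausdorff : hausdorff_space manifold_sort;
  manifold_second_countable : @second_countable manifold_sort;
  atlas : set (chart R n manifold_sort);
  atlas_cover : forall x, exists2 phi, atlas phi & chart_dom phi x;
  atlas_compatible : forall phi psi,
    atlas phi -> atlas psi -> smooth_transition phi psi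
}.

Definition smooth_function (R : realType) (n : nat) (M : smoothManifold R n)
    (f : M -> R) : Prop :=
  forall phi, @atlas _ _ M phi ->
    smooth_on (phi @` chart_dom phi) (f \o chart_inv phi).

(* The covector [df] at [x], evaluated on the tangent vector whose coordinates
   in the chart [phi] are [v]. *)
Definition dchart (R : realType) (n : nat) (M : topologicalType)
    (phi : chart R n M) (f : M -> R) (x : M) (v : 'rV[R]_n) : R :=
  'D_v (f \o chart_inv phi) (phi x).

Definition differentials_independent (R : realType) (n : nat)
    (M : smoothManifold R n) (N : nat) (r : 'I_N -> M -> R)
    (J : {set 'I_N}) (x : M) : Prop :=
  forall phi, @atlas _ _ M phi -> chart_dom phi x ->
  forall c : 'I_N -> R,
    (forall v, \sum_(j in J) c j * dchart phi (r j) x v = 0) ->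
    forall j, j \in J -> c j = 0.

Definition corner_body (M : Type) (R : realType) (N : nat)
    (r : 'I_N -> M -> R) : set M := [set x | forall j, 0 <= r j x].

Record manifoldWithCorners (R : realType) (n : nat) := ManifoldWithCorners {
  ambient : smoothManifold R n;
  nb_hyperfaces : nat;
  rdef : 'I_nb_hyperfaces -> ambient -> R;
  rdef_smooth : forall j, smooth_function (rdef j);
  hyperface_connected :
    forall j, connected (corner_body rdef `&` [set x | rdef j x = 0]);
  rdef_independent : forall (J : {set 'I_nb_hyperfaces}) (x : ambient),
    (forall j, j \in J -> rdef j x = 0) ->
    differentials_independent rdef J x
}.

Arguments nb_hyperfaces {R n}.
Arguments ambient {R n}.
Arguments rdef {R n}.

Section Faces.
Context {R : realType} {n : nat} (X : manifoldWithCorners R n).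
Local Notation N := (nb_hyperfaces X).

Definition body : set (ambient X) := corner_body (@rdef _ _ X).

Definition stratum (p : nat) : set (ambient X) :=
  [set x | body x /\ #|[set j | rdef X j x == 0]%SET| = p].

Definition open_faces (p : nat) : set (set (ambient X)) :=
  [set f | exists2 x, stratum p x & f = connected_component (stratum p) x].

Definition face (p : nat) : choiceType := set_type (open_faces p).

Definition is_codimension (d : nat) : Prop :=
  open_faces d !=set0 /\ forall p, open_faces p !=set0 -> (p <= d)%N.

(* The indices [I] such that the face lies in [H_I]. *)
Definition face_index (f : set (ambient X)) : {set 'I_N} :=
  [set i | `[< f `<=` [set x | rdef X i x = 0] >]]%SET.

End Faces.

Arguments body {R n}.

(* The integral exterior algebra on [e_0, ..., e_(N-1)], with basis [e_I] indexed
   by subsets, [e_I] being the product of the [e_i], [i \in I], in increasing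
   order. Only its additive structure is used. *)
Definition ext (N : nat) := {ffun {set 'I_N} -> int}.

Definition ext_basis (N : nat) (I : {set 'I_N}) : ext N :=
  [ffun J => (J == I)%:R].

(* The cardinal in the exponent is [j - 1] when [i] is the [j]-th element of
   [I]. *)
Definition contract_basis (N : nat) (i : 'I_N) (I : {set 'I_N}) : ext N :=
  if i \in I then
    ext_basis (I :\ i)%SET *~ (-1) ^+ #|[set k in I | (k < i)%N]%SET|
  else 0.

Definition contract (N : nat) (i : 'I_N) (w : ext N) : ext N :=
  \sum_(I : {set 'I_N}) contract_basis i I *~ w I.

Lemma contract_ext_basis (N : nat) (i : 'I_N) (I : {set 'I_N}) :
  contract i (ext_basis I) = contract_basis i I.
Proof.
rewrite /contract (bigD1 I) //= ffunE eqxx big1 ?addr0 // => J /negbTE JI.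
by rewrite ffunE JI mulr0z.
Qed.

Lemma contractN (N : nat) (i : 'I_N) (w : ext N) :
  contract i (- w) = - contract i w.
Proof.
rewrite /contract -sumrN; apply: eq_bigr => I _.
by rewrite ffunE mulrNz.
Qed.

Section Homology.
Context {A B C : zmodType}.
Variables (f : {additive A -> B}) (g : {additive B -> C}).

Definition cycle_pred : {pred B} := fun x => g x == 0.

Lemma cycle_pred_closed : zmod_closed cycle_pred.
Proof.
split=> [|x y]; first by rewrite unfold_in /= raddf0.
by rewrite !unfold_in => /eqP gx /eqP gy; rewrite /= raddfB /= gx gy subr0.
Qed.

HB.instance Definition _ := GRing.isZmodClosed.Build B cycle_pred
  cycle_pred_closed.

Record cycles := Cycles { cycle_val : B; cycleP : cycle_val \in cycle_pred }.

HB.instance Definition _ := [isSub for cycle_val].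
HB.instance Definition _ := [Choice of cycles by <:].
HB.instance Definition _ := [SubChoice_isSubZmodule of cycles by <:].

(* The cycles that are boundaries. No hypothesis [g \o f = 0] is needed to form
   the quotient, which is [ker g / im f] as soon as [g \o f = 0]. *)
Definition boundary_pred : {pred cycles} :=
  fun z => `[< exists y, f y = cycle_val z >].

Lemma boundary_pred_closed : zmod_closed boundary_pred.
Proof.
split=> [|x y]; rewrite ?unfold_in.
  by apply/asboolP; exists 0; rewrite raddf0.
move=> /asboolP[a fa] /asboolP[b fb]; apply/asboolP; exists (a - b).
by rewrite raddfB /= fa fb.
Qed.

HB.instance Definition _ := GRing.isZmodClosed.Build cycles boundary_pred
  boundary_pred_closed.

Definition homology : zmodType := {ideal_quot boundary_pred}.

End Homology.

Section DirectSum.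
Variable V : nat -> zmodType.

Record dirsum := DirSum {
  dirsum_val : forall p, V p;
  dirsumP : `[< exists m, forall p, (m <= p)%N -> dirsum_val p = 0 >]
}.

HB.instance Definition _ := [isSub for dirsum_val].
HB.instance Definition _ := [Choice of dirsum by <:].

Lemma dirsum_zero_subproof :
  `[< exists m, forall p, (m <= p)%N -> (fun q => 0 : V q) p = 0 >].
Proof. by apply/asboolP; exists 0%N. Qed.

Lemma dirsum_opp_subproof (x : dirsum) :
  `[< exists m, forall p, (m <= p)%N ->
      (fun q => - dirsum_val x q) p = 0 >].
Proof.
case: x => x /= /asboolP[m xm]; apply/asboolP; exists m => p mp.
by rewrite xm ?oppr0.
Qed.

Lemma dirsum_add_subproof (x y : dirsum) :
  `[< exists m, forall p, (m <= p)%N ->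
      (fun q => dirsum_val x q + dirsum_val y q) p = 0 >].
Proof.
case: x y => [x /= /asboolP[m xm]] [y /= /asboolP[k yk]].
apply/asboolP; exists (maxn m k) => p; rewrite geq_max => /andP[mp kp].
by rewrite xm ?yk ?addr0.
Qed.

Definition dirsum_zero := DirSum dirsum_zero_subproof.
Definition dirsum_opp x := DirSum (dirsum_opp_subproof x).
Definition dirsum_add x y := DirSum (dirsum_add_subproof x y).

Lemma dirsum_addA : associative dirsum_add.
Proof. by move=> x y z; apply/val_inj/functional_extensionality_dep=> p;
  rewrite /= addrA. Qed.

Lemma dirsum_addC : commutative dirsum_add.
Proof. by move=> x y; apply/val_inj/functional_extensionality_dep=> p;
  rewrite /= addrC. Qed.

Lemma dirsum_add0 : left_id dirsum_zero dirsum_add.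
Proof. by move=> x; apply/val_inj/functional_extensionality_dep=> p;
  rewrite /= add0r. Qed.

Lemma dirsum_addN : left_inverse dirsum_zero dirsum_opp dirsum_add.
Proof. by move=> x; apply/val_inj/functional_extensionality_dep=> p;
  rewrite /= addNr. Qed.

HB.instance Definition _ := GRing.isZmodule.Build dirsum
  dirsum_addA dirsum_addC dirsum_add0 dirsum_addN.

End DirectSum.

Definition free_abelian (A : zmodType) : Prop :=
  exists (K : choiceType) (h : {additive {freeg K / int} -> A}), bijective h.

Section ConormalHomology.
Context {R : realType} {n : nat} (X : manifoldWithCorners R n).
Local Notation N := (nb_hyperfaces X).

Definition conormal_basis (f : set (ambient X)) : ext N :=
  ext_basis (face_index f).

Definition is_orientation (f : set (ambient X)) (w : ext N) : Prop :=
  w = conormal_basis f \/ w = - conormal_basis f.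

(* Every orientation of [N(f)] is [e_I] or [- e_I] and the symbols [f (x) e_I]
   and [f (x) (- e_I)] are opposite, so the module generated by the symbols is
   free on the [f (x) e_I], represented here by [f] itself. The lemmas
   [symbolN] and [chain_universal] say that [chain p], with [symbol], is indeed
   the module presented by these generators and relations. *)
Definition chain (p : nat) : lmodType int := {freeg (face X p) / int}.

Definition symbol (p : nat) (f : face X p) (w : ext N) : chain p :=
  << w (face_index (val f)) *g f >>.

Definition incident (p : nat) (f : face X p) : set (face X p.-1) :=
  [set g | val f `<=` closure (val g)].

(* The index of the defining function which vanishes on [f] but not on [g]; it
   is unique when [f] has codimension one in the closure of [g]. *)
Definition lost_index (g f : set (ambient X)) : option 'I_N :=
  [pick i in (face_index f :\: face_index g)%SET].

Definition contract_lost (g f : set (ambient X)) (w : ext N) : ext N :=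
  if lost_index g f is Some i then contract i w else 0.

(* For [0 < p] the sum has at most [p] terms. *)
Definition symbol_boundary (p : nat) (f : face X p) (w : ext N) :
    chain p.-1 :=
  if p is 0 then 0
  else \sum_(g \in incident f) symbol g (contract_lost (val g) (val f) w).

Definition delta (p : nat) : chain p -> chain p.-1 :=
  fglift (fun f => symbol_boundary f (conormal_basis (val f))).

HB.instance Definition _ (p : nat) :=
  GRing.isZmodMorphism.Build (chain p) (chain p.-1) (@delta p)
    (lift_is_additive _).

Lemma symbol_basis p (f : face X p) :
  symbol f (conormal_basis (val f)) = << 1 *g f >>.
Proof. by rewrite /symbol /conormal_basis ffunE eqxx. Qed.

Lemma symbolN p (f : face X p) w : symbol f (- w) = - symbol f w.
Proof. by rewrite /symbol ffunE freegUN. Qed.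

Lemma contract_lostN g f w : contract_lost g f (- w) = - contract_lost g f w.
Proof.
by rewrite /contract_lost; case: lost_index => [i|]; rewrite ?oppr0 ?contractN.
Qed.

Lemma symbol_boundaryN p (f : face X p) w :
  symbol_boundary f (- w) = - symbol_boundary f w.
Proof.
rewrite /symbol_boundary; case: p f => [|p] f; first by rewrite oppr0.
pose F w (g : face X p) := symbol g (contract_lost (val g) (val f) w).
have FN g : F (- w) g = - F w g by rewrite /F contract_lostN symbolN.
have -> : finite_support 0 (incident f) (F (- w)) =
    finite_support 0 (incident f) (F w).
  have E : F (- w) @^-1` [set~ 0] = F w @^-1` [set~ 0].
    apply/seteqP; split=> g /= nz Fg; apply: nz; first by rewrite FN Fg oppr0.
    by apply: oppr_inj; rewrite -FN Fg oppr0.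
  by rewrite /finite_support !unlock E.
by rewrite -sumrN; apply: eq_bigr => g _; exact: FN.
Qed.

Lemma delta_symbol p (f : face X p) w : is_orientation (val f) w ->
  delta (symbol f w) = symbol_boundary f w.
Proof.
have deltaE : delta (symbol f (conormal_basis (val f))) =
    symbol_boundary f (conormal_basis (val f)).
  by rewrite symbol_basis /delta /= liftU scale1r.
by case=> -> //; rewrite symbolN raddfN /= symbol_boundaryN -deltaE.
Qed.

Lemma chain_universal p (A : zmodType) (phi : face X p -> ext N -> A) :
  (forall f w, is_orientation (val f) w -> phi f (- w) = - phi f w) ->
  exists h : {additive chain p -> A},
    (forall f w, is_orientation (val f) w -> h (symbol f w) = phi f w) /\
    (forall h' : {additive chain p -> A},
      (forall f w, is_orientation (val f) w -> h' (symbol f w) = phi f w) ->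
      h' =1 h).
Proof.
move=> phiN; pose e f := conormal_basis (val (f : face X p)).
pose h0 (x : chain p) : A := \sum_(f <- dom x) phi f (e f) *~ coeff f x.
have h0E (x : chain p) (s : seq (face X p)) : uniq s -> {subset dom x <= s} ->
    h0 x = \sum_(f <- s) phi f (e f) *~ coeff f x.
  move=> us xs; rewrite (bigID (mem (dom x))) /= addrC big1; last first.
    by move=> f /coeff_outdom ->.
  rewrite add0r -big_filter; apply: perm_big; apply: uniq_perm.
  - exact: uniq_dom.
  - exact: filter_uniq.
  by move=> f; rewrite mem_filter andb_idr //; exact: xs.
have h0B : zmod_morphism h0.
  move=> x y; pose s := undup (dom x ++ dom y).
  have us : uniq s by exact: undup_uniq.
  rewrite (h0E (x - y) s) //; last first.
    by move=> f /domB; rewrite mem_undup.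
  rewrite (h0E x s) // => [|f fx]; last by rewrite mem_undup mem_cat fx.
  rewrite (h0E y s) // => [|f fy]; last by rewrite mem_undup mem_cat fy orbT.
  by rewrite -sumrB; apply: eq_bigr => f _; rewrite coeffB mulrzBr.
pose hM := GRing.isZmodMorphism.Build _ _ h0 h0B.
pose h : {additive chain p -> A} := HB.pack h0 hM.
have he f : h (symbol f (e f)) = phi f (e f).
  rewrite symbol_basis /= (h0E _ [:: f]) //; last first.
    by move=> g; rewrite domU1.
  by rewrite big_seq1 coeffU eqxx.
exists h; split=> [f w [->|->]|h' h'E x]; first exact: he.
  by rewrite symbolN raddfN he phiN //; left.
rewrite -[x]freeg_sumE !raddf_sum; apply: eq_bigr => f _.
have -> : << coeff f x *g f >> = << (1 : int) *g f >> *~ coeff f x :> chain p.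
  by rewrite freeg_mulz -mulrzl mulr1 intz.
rewrite !raddfMz -symbol_basis h'E ?he //; last by left.
Qed.

Definition conormal_homology (p : nat) : zmodType :=
  homology (@delta p.+1) (@delta p).

Definition pcn_homology0 : zmodType :=
  dirsum (fun p => conormal_homology (2 * p)%N).

Definition pcn_homology1 : zmodType :=
  dirsum (fun p => conormal_homology (2 * p).+1%N).

End ConormalHomology.

Arguments pcn_homology0 {R n}.
Arguments pcn_homology1 {R n}.

(* Main.v *)
(** Subgroups of free abelian groups are free, so it suffices to embed each
    [C_p / im delta_(p+1)] in a free abelian group. At a point of codimension
    [p + 1 <= 2],
      the faces of codimension [p] having that point in their closure
    are determined by their indices,
      because the corresponding strata are locally
    connected there. Hence the boundary of a generator [f] has at most two
      terms,
    with opposite signs: it is a difference [u - v], where [u] and [v] are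
    generators or zero. The quotient by such differences is free on the
    components of a graph, except the component of zero.

    Local connectedness avoids straightening charts: two points of [r_j > 0]
    near a zero of [r_j] are joined by moving both along a direction in which
    [r_j] grows, and inside a hyperface [r_i = 0] the same argument applies
    after composing [r_j] with a retraction onto [r_i = 0] given by a
    one-variable implicit function. *)

Require Import Defs.
From HB Require Import structures.
From mathcomp Require Import all_boot all_order all_algebra.
From mathcomp Require Import all_classical all_reals all_analysis.
From mathcomp.multinomials Require Import freeg.
From mathcomp Require Import ring lra.

Set Implicit Arguments.
Unset Strict Implicit.
Unset Printing Implicit Defensive.

Import Order.TTheory GRing.Theory Num.Theory.
Import numFieldNormedType.Exports.

Local Open Scope classical_set_scope.
Local Open Scope ring_scope.

(** * Subgroups and quotients of free abelian groups *)

Section Linear.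
Variables (K : choiceType) (A : zmodType) (f : K -> A).

(** The universal map out of the free group, with [A] seen as a module over the integers through
    [zmodule]. *)
Definition zlift (x : {freeg K / int}) : A := @fglift int (zmodule A) K f x.

Lemma zlift_is_zmod_morphism : zmod_morphism zlift.
Proof. exact: (@lift_is_additive int K (zmodule A) f). Qed.

HB.instance Definition _ :=
  GRing.isZmodMorphism.Build {freeg K / int} A zlift zlift_is_zmod_morphism.

Lemma zliftU k z : zlift << z *g k >> = f k *~ z.
Proof. exact: (@liftU int (zmodule A) K f). Qed.

End Linear.

Lemma freegUz (K : choiceType) (k : K) (z : int) :
  << z *g k >> = << 1 *g k >> *~ z :> {freeg K / int}.
Proof. by rewrite freeg_mulz intz. Qed.

Lemma freeg_ext (K : choiceType) (A : zmodType) (h h' : {additive {freeg K /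
  int} -> A}) :
  (forall k, h << 1 *g k >> = h' << 1 *g k >>) -> h =1 h'.
Proof.
move=> hh' x; rewrite -[x]freeg_sumE !raddf_sum; apply: eq_bigr => k _.
by rewrite freegUz !raddfMz hh'.
Qed.

Lemma coeffMz (K : choiceType) (k : K) (x : {freeg K / int}) (z : int) :
  coeff k (x *~ z) = coeff k x * z.
Proof. by rewrite raddfMz -mulrzr intz. Qed.

(** Carried along in place of freeness because it passes directly to subgroups and direct sums;
    [embeds_free_abelian] recovers freeness at the end. *)
Definition embeds_in_free (A : zmodType) : Prop :=
  exists (K : choiceType) (j : {additive A -> {freeg K / int}}), injective j.

(** * Well-orders on a set of generators *)

Section WellOrder.
Variables (K : eqType) (R : rel K).
Hypothesis Rwo : wochoice.well_order R.

Lemma wo_refl : reflexive R.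
Proof.
have := wochoice.wo_chain_reflexive (C := xpredT) (fun A _ => Rwo (A := A)).
by move=> H x; apply: H.
Qed.

Lemma wo_total : total R.
Proof.
have := wochoice.wo_chainW (C := xpredT) (fun A _ => Rwo (A := A)).
by move=> H x y; apply: H.
Qed.

Lemma wo_anti : antisymmetric R.
Proof.
have := wochoice.wo_chain_antisymmetric (C := xpredT) (fun A _ => Rwo (A := A)).
by move=> H x y; apply: H.
Qed.

Lemma wo_trans : transitive R.
Proof.
move=> y x z xy yz.
(* Compare the least of the three points with the others: if it is [x] the claim is immediate,
   otherwise antisymmetry identifies [x] with [y] or [y] with [z]. *)
have [|m [[]]] := Rwo (A := mem [:: x; y; z]); first by exists x;
  exact: mem_head.
rewrite !inE => /or3P[]/eqP-> lb _.
- by apply: lb; rewrite !inE eqxx !orbT.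
- by have -> // : x = y; apply/wo_anti; rewrite xy lb ?inE ?eqxx.
- by have <- // : y = z; apply/wo_anti; rewrite yz lb ?inE ?eqxx ?orbT.
Qed.

Lemma wo_ind (P : K -> Prop) :
  (forall k, (forall l, R l k -> l != k -> P l) -> P k) -> forall k, P k.
Proof.
move=> IH k; apply: contrapT => nPk.
have [|m [[]]] := Rwo (A := fun k => `[< ~ P k >]); first by exists k;
  apply/asboolP.
move=> /asboolP nPm lb _; apply: nPm; apply: IH => l lm nlm.
apply: contrapT => nPl; move/eqP: nlm; apply; apply/wo_anti.
by rewrite lm lb //; apply/asboolP.
Qed.

Lemma wo_max (s : seq K) : s != [::] ->
  exists2 m, m \in s & forall x, x \in s -> R x m.
Proof.
elim: s => // x [_ _|y s /(_ isT)[m ms mmax] _].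
  by exists x; rewrite ?inE // => z; rewrite inE => /eqP->; exact: wo_refl.
have [xm|mx] := orP (wo_total x m).
  by exists m => [|z]; rewrite in_cons ?ms ?orbT // => /predU1P[->|/mmax].
exists x => [|z]; rewrite in_cons ?eqxx // => /predU1P[->|/mmax zm].
  exact: wo_refl.
exact: wo_trans zm mx.
Qed.

End WellOrder.

(* Order the generators well. For each generator [k] the coefficients at [k] of
   the elements of the subgroup supported on [l <= k] form an ideal; an element
   realizing its generator, for each [k] with a nonzero ideal, gives a basis. *)
Lemma embeds_free_abelian (A : zmodType) : embeds_in_free A -> free_abelian A.
Proof.
move=> [K [j jinj]].
have [R Rwo] := wochoice.well_ordering_principle K.
pose below k (x : {freeg K / int}) := forall l, coeff l x != 0 -> R l k.
have belowB k x y : below k x -> below k y -> below k (x - y).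
  move=> bx by_ l; rewrite coeffB; have [->|/bx//] := eqVneq (coeff l x) 0.
  by rewrite sub0r oppr_eq0 => /by_.
have belowM k x z : below k x -> below k (x *~ z).
  move=> bx l; rewrite coeffMz mulf_eq0 negb_or => /andP[/bx//].
pose good k := exists2 a, below k (j a) & coeff k (j a) != 0.
have goodP k : good k -> exists a, [/\ below k (j a), coeff k (j a) != 0 &
    forall b, below k (j b) -> exists q, coeff k (j b) = q * coeff k (j a)].
  move=> gk.
  pose P (n : nat) :=
    `[< (0 < n)%N /\ exists2 a, below k (j a) & coeff k (j a) = n%:Z >].
  have exP : exists n, P n.
    case: gk => a ba; case E : (coeff k (j a)) => [[|n]|n] // _; exists n.+1;
      apply/asboolP.
      by split=> //; exists a.
    (* A negative coefficient at [k] becomes positive for [- a]. *)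
    split=> //; exists (- a).
      by rewrite raddfN -sub0r; apply: belowB => // l; rewrite coeff0 eqxx.
    by rewrite raddfN coeffN E NegzE opprK.
  case: (ex_minnP exP) => n /asboolP[n0 [a ba an]] nmin; exists a; split=> //.
    by rewrite an eqz_nat -lt0n.
  move=> b bb; exists (coeff k (j b) %/ n%:Z)%Z; rewrite an.
  (* The remainder [r] is again the coefficient at [k] of an element supported below [k]; being less
     than the minimal positive value [n], it is zero. *)
  set c := coeff k (j b); pose r := (c %% n%:Z)%Z.
  have nz : n%:Z != 0 by rewrite eqz_nat -lt0n.
  have r0 : 0 <= r by rewrite modz_ge0.
  have rn : r < n%:Z by rewrite ltz_pmod.
  have cE : coeff k (j (b - a *~ (c %/ n%:Z)%Z)) = r.
    rewrite raddfB raddfMz coeffB coeffMz an -/c {1}(divz_eq c n%:Z) -/r.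
    by rewrite mulrC addrAC subrr add0r.
  rewrite {1}(divz_eq c n%:Z) -/r.
  case: (r) r0 rn cE => [[|m]|m] // _; first by rewrite addr0.
  rewrite ltz_nat ltnNge => /negP mn E; case: mn; apply: nmin; apply/asboolP;
    split=> //.
  by exists (b - a *~ (c %/ n%:Z)%Z) => //; rewrite raddfB raddfMz;
    apply/belowB/belowM.
pose K' : choiceType := set_type [set k | good k].
have /choice[a aP] (k : K') : exists a, [/\ below (val k) (j a),
  coeff (val k) (j a) != 0 &
    forall b, below (val k) (j b) -> exists q,
      coeff (val k) (j b) = q * coeff (val k) (j a)].
  by apply: goodP; exact: (set_valP k).
(* At the largest generator [k0] in the support of [x], only the term of [k0] contributes, since
   [j (a l)] is supported below [l]; that contribution is nonzero. *)
have h_inj : injective (zlift a).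
  apply: raddf_inj => x hx; apply/eqP; apply: contraT => nx.
  have domx : [seq val k | k <- dom x] != [::].
    by move: nx; rewrite -dom_eq0; case: (dom x).
  have [k /mapP[k0 k0x ->] kmax] := wo_max Rwo domx.
  have : coeff (val k0) (j (zlift a x)) == 0 by rewrite hx raddf0 coeff0.
  rewrite -{1}[x]freeg_sumE !raddf_sum (bigD1_seq k0) ?uniq_dom //=
    big1_seq ?addr0; last first.
    move=> l /andP[nl lx]; rewrite zliftU raddfMz coeffMz.
    have [->|nc] := eqVneq (coeff (val k0) (j (a l))) 0; first by rewrite mul0r.
    have [bl _ _] := aP l; have := bl _ nc => kl.
    have lk := kmax _ (map_f _ lx); case/negP: nl;
      apply/eqP/val_inj/(wo_anti Rwo).
    by rewrite lk kl.
  rewrite zliftU raddfMz coeffMz mulf_eq0.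
  by have [_ /negbTE-> _] := aP k0; move: k0x; rewrite mem_dom => /negbTE->.
have h_surj b : exists x, zlift a x = b.
  (* Induction on a bound [k] of the support: a multiple of [a k] cancels the coefficient at [k],
     and the finite support of the remainder has a strictly smaller maximum. *)
  have reduction k : forall b, below k (j b) -> exists x, zlift a x = b.
    elim/(wo_ind Rwo): k => k IH c bc.
    have step d : below k (j d) -> coeff k (j d) = 0 -> exists x, zlift a x = d.
      move=> bd dk; have [jd0|nd] := eqVneq (j d) 0.
        by exists 0; rewrite raddf0; apply: jinj; rewrite raddf0.
      have [|l ld lmax] := wo_max Rwo (s := dom (j d)); first
        by rewrite dom_eq0.
      move: ld; rewrite mem_dom => ld.
      apply: (IH l); first exact: bd.
        by apply: contra_neq ld => ->.
      by move=> m md; apply: lmax; rewrite mem_dom.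
    have [ck|ck] := eqVneq (coeff k (j c)) 0; first exact: step.
    have gk : k \in [set k | good k] by rewrite inE; exists c.
    pose k' : K' := SigSub gk.
    have [ba na /(_ _ bc)[q qE]] := aP k'.
    have [||x xE] := step (c - a k' *~ q).
    - by rewrite raddfB raddfMz; apply/belowB/belowM.
    - by rewrite raddfB raddfMz coeffB coeffMz qE mulrC subrr.
    exists (x + << q *g k' >>); rewrite raddfD /= zliftU xE subrK //.
  have [jb0|nb] := eqVneq (j b) 0.
    by exists 0; rewrite raddf0; apply: jinj; rewrite raddf0.
  have [|l ld lmax] := wo_max Rwo (s := dom (j b)); first by rewrite dom_eq0.
  by apply: (reduction l) => m md; apply: lmax; rewrite mem_dom.
exists K', (zlift a); have /choice[g gK] := h_surj.
by exists g => // x; apply: h_inj; rewrite gK.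
Qed.

(** * Homology groups and direct sums inside free groups *)

Section HomologyEmbedding.
Variables (A B C : zmodType) (f : {additive A -> B}) (g : {additive B -> C}).
Variables (K : choiceType) (q : {additive B -> {freeg K / int}}).
Hypothesis qf : forall a, q (f a) = 0.
Hypothesis kerq : forall x, q x = 0 -> exists a, f a = x.

Let qbar (u : homology f g) : {freeg K / int} := q (cycle_val (repr u)).

Let qbar_pi (z : cycles g) :
  qbar (\pi_(homology f g) z)%qT = q (cycle_val z).
Proof.
apply/eqP; rewrite -subr_eq0 -raddfB.
set r := repr _; have : r - z \in boundary_pred f (g := g).
  by rewrite Quotient.idealrBE reprK.
by rewrite unfold_in => /asboolP[a fa]; rewrite -[_ - _]fa qf.
Qed.

(** Since [q] kills exactly the image of [f], it embeds the cokernel of [f], and the homology is a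
    subgroup of that cokernel. By [qbar_pi] the chosen representatives do not matter. *)
Lemma homology_embeds_in_free : embeds_in_free (homology f g).
Proof.
have qbarB : zmod_morphism qbar.
  move=> u v; rewrite -{1}[u]reprK -{1}[v]reprK -[_ - _]raddfB.
  by rewrite qbar_pi -raddfB.
pose qM := GRing.isZmodMorphism.Build _ _ qbar qbarB.
pose h : {additive homology f g -> {freeg K / int}} := HB.pack qbar qM.
exists K, h; apply: raddf_inj => u; rewrite -[u]reprK => qu.
have /kerq[a fa] : q (cycle_val (repr u)) = 0 by rewrite -qbar_pi.
have : repr u - 0 \in boundary_pred f (g := g).
  by rewrite subr0 unfold_in; apply/asboolP; exists a.
by rewrite Quotient.idealrBE => /eqP->; rewrite raddf0.
Qed.

End HomologyEmbedding.

(** The embeddings of the summands combine into one with values in the free group on the disjoint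
    union of their generators. *)
Lemma dirsum_embeds_in_free (V : nat -> zmodType) :
  (forall p, embeds_in_free (V p)) -> embeds_in_free (dirsum V).
Proof.
move=> Vfree; pose K p := projT1 (cid (Vfree p)).
pose j p : {additive V p -> {freeg (K p) / int}} :=
  projT1 (cid (projT2 (cid (Vfree p)))).
have jinj p : injective (j p) := projT2 (cid (projT2 (cid (Vfree p)))).
pose e p : {additive {freeg (K p) / int} -> {freeg {p : nat & K p} / int}} :=
  zlift (fun k => << 1 *g Tagged K k >>).
have eE p (k : K p) x : coeff (Tagged K k) (e p x) = coeff k x.
  have := @freeg_ext _ _ (coeff (Tagged K k) \o e p) (coeff k); apply=> l /=.
  by rewrite zliftU !coeffU eq_Tagged.
have eN p q (k : K p) x : p != q -> coeff (Tagged K k) (e q x) = 0.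
  move=> pq; have := @freeg_ext _ _ (coeff (Tagged K k) \o e q) \0;
    apply=> l /=.
  rewrite zliftU !coeffU; case: eqP => [E|]; rewrite ?mulr0 //.
  by case/eqP: pq; have := congr1 tag E.
pose m (x : dirsum V) := projT1 (cid (asboolW (dirsumP x))).
have mP x p : (m x <= p)%N -> dirsum_val x p = 0 :=
  projT2 (cid (asboolW (dirsumP x))) p.
pose h (x : dirsum V) := \sum_(p < m x) e p (j p (dirsum_val x p)).
(* The bound [m x] is chosen and need not be compatible with addition; the coefficients of [h x] do
   not depend on it, and additivity and injectivity are read off from them. *)
have hE x p (k : K p) : coeff (Tagged K k) (h x) = coeff k (j p (dirsum_val x
  p)).
  rewrite /h raddf_sum; have [pm|pm] := ltnP p (m x).
    rewrite (bigD1 (Ordinal pm)) //= eE big1 ?addr0 // => q.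
    by rewrite -val_eqE /= eq_sym; exact: eN.
  rewrite mP // raddf0 coeff0 big1 // => q _; apply: eN.
  by rewrite neq_ltn orbC (leq_trans (ltn_ord q) pm).
have hB : zmod_morphism h.
  move=> x y; apply/eqP/freeg_eqP => -[p k].
  by rewrite coeffB !hE /= raddfB coeffB.
pose hM := GRing.isZmodMorphism.Build _ _ h hB.
pose h' : {additive dirsum V -> {freeg {p : nat & K p} / int}} := HB.pack h hM.
exists {p : nat & K p}, h' => x y hxy;
  apply/val_inj/functional_extensionality_dep => p.
apply: jinj; apply/eqP/freeg_eqP => k.
by rewrite -!hE; congr (coeff _ _).
Qed.

Definition freeg_option (K : choiceType) (u : option K) : {freeg K / int} :=
  if u is Some k then << 1 *g k >> else 0.

(* The quotient is free on the components of the graph with vertices [option K]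
   and edges [L], the component of [None] being killed; [q] sends a vertex to a
   representative of its component. *)
Lemma graph_cokernel (K L : choiceType)
    (B : {additive {freeg L / int} -> {freeg K / int}}) :
  (forall l, exists u v, B << 1 *g l >> = freeg_option u - freeg_option v) ->
  exists q : {additive {freeg K / int} -> {freeg K / int}},
    (forall x, q (B x) = 0) /\ (forall x, q x = 0 -> exists y, B y = x).
Proof.
move=> Bgraph.
pose im x := exists y, B y = x.
pose r u v := im (freeg_option u - freeg_option v).
have imD x y : im x -> im y -> im (x + y).
  by move=> [a <-] [b <-]; exists (a + b); rewrite raddfD.
have rxx u : r u u by exists 0; rewrite raddf0 subrr.
have rC u v : r u v -> r v u.
  by move=> [a aE]; exists (- a); rewrite raddfN aE opprB.
have rT u v w : r u v -> r v w -> r u w.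
  by move=> [a aE] [b bE]; exists (a + b); rewrite raddfD aE bE addrA subrK.
(* The choice depends only on the class [r u], so equivalent vertices get the same representative;
   the class of [None] is sent to [None], that is, to zero. *)
pose s u := if `[< r u None >] then None else xget None (r u).
have rs u : r u (s u).
  rewrite /s; case: ifPn => [/asboolP//|_].
  by case: xgetP => [? -> //|/(_ u) []].
have sE u v : r u v -> s u = s v.
  move=> ruv; suff E : r u = r v by rewrite /s E.
  by apply/funext => w; apply/propext; split; apply: rT => //; apply: rC.
have sN : s None = None by rewrite /s asboolT.
pose q : {additive {freeg K / int} -> {freeg K / int}} :=
  zlift (fun k => freeg_option (s (Some k))).
have qE u : q (freeg_option u) = freeg_option (s u).
  by case: u => [k|]; [rewrite /= zliftU|rewrite sN raddf0].
exists q; split=> [x|x qx].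
  have := @freeg_ext _ _ (q \o B) \0; apply=> l /=.
  have [u [v Buv]] := Bgraph l; rewrite Buv raddfB !qE (@sE u v) ?subrr //.
  by rewrite /r -Buv; exists << 1 *g l >>.
(* [x - q x] is a combination of differences between a vertex and its representative, each of which
   is in the image. *)
suff : im (x - q x) by rewrite qx subr0.
rewrite -[x]freeg_sumE raddf_sum -sumrB.
apply: (big_ind im) => [|y z iy iz|k _].
- by exists 0; rewrite raddf0.
- exact: imD.
have [y yE] := rs (Some k); exists (y *~ coeff k x).
by rewrite freegUz !raddfMz yE /= zliftU mulrzBl mulr1z mulNrz.
Qed.

(** * Strict directional derivatives and local connectedness *)

Section StrictSlope.
Context {R : realType} {E : normedModType R}.
Implicit Types (F G : E -> R) (a u v w : E).

Lemma cvg_add_scale (T : Type) (Fl : set_system T) {FF : Filter Fl}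
    (f : T -> E) (s : T -> R) a v :
  f @ Fl --> a -> s @ Fl --> 0 -> (fun x => f x + s x *: v) @ Fl --> a.
Proof.
move=> fa s0; rewrite -[a]addr0 -(scale0r v).
by apply: cvgD => //; exact: cvgZr_tmp.
Qed.

(* Strict differentiability at [a] along [v], with derivative [A]; unlike
   directional derivatives, strict ones are additive in [v]. *)
Definition strict_slope F a v (A : R) : Prop :=
  forall e, 0 < e -> \forall p \near (a, 0 : R),
    `|F (p.1 + p.2 *: v) - F p.1 - A * p.2| <= e * `|p.2|.

Lemma strict_slope_near F a v A (T : topologicalType) (x0 : T)
    (f : T -> E) (s : T -> R) e : strict_slope F a v A ->
  f @ x0 --> a -> s @ x0 --> 0 -> 0 < e -> \forall x \near x0,
    `|F (f x + s x *: v) - F (f x) - A * s x| <= e * `|s x|.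
Proof.
move=> slF fa s0 e0.
have fs : (fun x => (f x, s x)) @ x0 --> (a, 0 : R).
    exact: (@cvg_pair _ _ _ _ (nbhs a) (nbhs (0 : R))).
by have := fs _ (slF e e0).
Qed.

(** Move along [v] first, then along [w] from the displaced point; strictness controls the second
    increment although its base point moves. *)
Lemma strict_slope_comb F a v w A B k : strict_slope F a v A ->
  strict_slope F a w B -> strict_slope F a (k *: v + w) (k * A + B).
Proof.
move=> slA slB e e0;
have c1 : (fun p : E * R => p.1) @ (a, 0 : R) --> a by exact: cvg_fst.
have c2 : (fun p : E * R => p.2) @ (a, 0 : R) --> (0 : R) by exact: cvg_snd.
have c3 : (fun p : E * R => p.2 * k) @ (a, 0 : R) --> (0 : R).
  by rewrite -[X in _ --> X](mul0r k); apply: cvgMr_tmp.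
have c4 : (fun p : E * R => p.1 + (p.2 * k) *: v) @ (a, 0 : R) --> a.
  exact: cvg_add_scale.
(* This tolerance absorbs the factor [|k|] of the first displacement; the added 1 covers [k = 0]. *)
have d0 : 0 < e / (2 * (1 + `|k|))
  by rewrite divr_gt0 // mulr_gt0 // ltr_pwDl //.
have e20 : 0 < e / 2 by rewrite divr_gt0.
have nA := strict_slope_near slA c1 c3 d0.
have nB := strict_slope_near slB c4 c2 e20.
apply: (filterS _ (filterI nA nB)) => p /= [hA hB].
rewrite scalerDr scalerA addrA.
set x := F (_ + _ + _) in hB *; set y := F (_ + _) in hA hB *.
have -> : x - F p.1 - (k * A + B) * p.2 =
  (x - y - B * p.2) + (y - F p.1 - A * (p.2 * k)) by ring.
apply: le_trans (ler_normD _ _) _.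
have -> : e * `|p.2| = e / 2 * `|p.2| + e / 2 * `|p.2| by field.
apply: lerD => //; apply: (le_trans hA).
rewrite normrM; have := normr_ge0 k; have := normr_ge0 p.2.
set P := `|p.2|; set K := `|k| => P0 K0.
have -> : e / (2 * (1 + K)) * (P * K) = e / 2 * P * (K / (1 + K)).
  by field; apply: lt0r_neq0; rewrite ltr_pwDl.
rewrite ler_piMr ?mulr_ge0 ?divr_ge0 ?(ltW e0) // ler_pdivrMr ?ltr_pwDl //
  mul1r.
by rewrite lerDr.
Qed.

Lemma derive_line F u v t : derivable F (u + t *: v) v ->
  is_derive t 1 (fun s : R => F (u + s *: v)) ('D_v F (u + t *: v)).
Proof.
move=> dF.
have E1 : (fun h : R => h^-1 *: (((fun s : R =>
  F (u + s *: v)) \o shift t) (h *: 1)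
     - F (u + t *: v))) =
   (fun h : R => h^-1 *: ((F \o shift (u + t *: v)) (h *: v) - F (u + t *: v))).
  apply/funext => h /=; congr (_ *: (F _ - _)).
  by rewrite scalerDl addrCA [h *: 1]mulr1.
by split; [move: dF; rewrite /derivable -E1 | rewrite /derive -E1].
Qed.

(** Strict slopes are two-sided, so both signs of [s] occur; each reduces to the mean value theorem
    on the segment between [0] and [s]. *)
Lemma mvt_line F u v (s : R) : (forall t : R, `|t| <= `|s| ->
  derivable F (u + t *: v) v) ->
  exists2 t, `|t| <= `|s| & F (u + s *: v) - F u = 'D_v F (u + t *: v) * s.
Proof.
move=> dF; pose h (t : R) := F (u + t *: v).
have dh (t : R) : `|t| <= `|s| -> is_derive t 1 h ('D_v F (u + t *: v)).
  by move=> /dF; exact: derive_line.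
have ch (a b : R) : (forall t, t \in `[a, b] -> `|t| <= `|s|) -> {within `[a,
  b], continuous h}.
  move=> ab; apply: derivable_within_continuous => t /ab /dh; case.
  by [].
have h0 : h 0 = F u by rewrite /h scale0r addr0.
have [s0|/ltW s0] := leP 0 s.
  have sub (t : R) : t \in `[0, s] -> `|t| <= `|s|.
    by rewrite in_itv /= => /andP[t0 ts]; rewrite !ger0_norm.
  have [|||t ts] := @MVT_segment R h (fun t => 'D_v F (u + t *: v)) 0 s.
  - by [].
  - by move=> t ti; apply/dh/sub/(subset_itv_oo_cc ti).
  - exact: ch.
  by rewrite h0 subr0 => tE; exists t => //; apply: sub.
have sub (t : R) : t \in `[s, 0] -> `|t| <= `|s|.
  by rewrite in_itv /= => /andP[st t0]; rewrite !ler0_norm // lerN2.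
have [|||t ts] := @MVT_segment R h (fun t => 'D_v F (u + t *: v)) s 0.
- by [].
- by move=> t ti; apply/dh/sub/(subset_itv_oo_cc ti).
- exact: ch.
rewrite h0 sub0r mulrN => /(congr1 -%R); rewrite opprK opprB => tE.
by exists t => //; apply: sub.
Qed.

Lemma near_segment (P : set E) a v : nbhs a P ->
  \forall p \near (a, 0 : R), forall t, `|t| <= `|p.2| -> P (p.1 + t *: v).
Proof.
move=> /nbhs_ballP[e /= e0 aP].
have c1 : (fun p : E * R => p.1) @ (a, 0 : R) --> a by exact: cvg_fst.
have c2 : (fun p : E * R => p.2) @ (a, 0 : R) --> (0 : R) by exact: cvg_snd.
have e20 : 0 < e / 2 by rewrite divr_gt0.
have d0 : 0 < e / (2 * (1 + `|v|))
  by rewrite divr_gt0 // mulr_gt0 // ltr_pwDl //.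
have /cvgrPdist_lt/(_ _ e20) n1 := c1.
have /cvgrPdist_lt/(_ _ d0) n2 := c2.
apply: (filterS _ (filterI n1 n2)) => p /= [h1 h2] t tp.
apply: aP; rewrite -ball_normE /ball_ /= opprD addrA.
apply: le_lt_trans (ler_normB _ _) _.
rewrite (splitr e); apply: ltrD; first exact: h1.
rewrite normrZ.
have := h2; rewrite sub0r normrN.
rewrite ltr_pdivlMr ?mulr_gt0 ?ltr_pwDl // ltr_pdivlMr // => h.
have := ler_wpM2r (normr_ge0 v) tp; have := normr_ge0 p.2; lra.
Qed.

(** By the mean value theorem the increment is governed by ['D_v F] at a point of a short segment,
    where it is close to its value at [a]. *)
Lemma C1_strict_slope F a v : (\forall x \near a, derivable F x v) ->
  {for a, continuous ('D_v F)} -> strict_slope F a v ('D_v F a).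
Proof.
move=> dF cF e e0.
have /cvgrPdist_le/(_ _ e0) n1 := cF.
apply: (filterS _ (near_segment v (filterI dF n1))) => p pP.
have [t /pP[dt]|t tp ->] := @mvt_line F p.1 v p.2; first by [].
have [_ /= ct] := pP _ tp.
by rewrite -mulrBl normrM ler_wpM2r // distrC.
Qed.

End StrictSlope.

Lemma path_connected_component (R : realType) (T : topologicalType) (g : R -> T)
    (A : set T) (s : R) : 0 <= s -> continuous g ->
  (forall t, 0 <= t <= s -> A (g t)) -> connected_component A (g 0) (g s).
Proof.
move=> s0 cg Ag; exists (g @` `[0, s]); last first.
  by exists s => //=; rewrite in_itv /= s0 lexx.
split.
- by exists 0 => //=; rewrite in_itv /= s0 lexx.
- by move=> _ [t /=+ <-]; rewrite in_itv /=; exact: Ag.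
apply: connected_continuous_connected; first exact: segment_connected.
exact: continuous_subspaceT.
Qed.

(** * Linking points of a superlevel set *)

Section Superlevel.
Context {R : realType} {E : normedModType R}.
Implicit Types (a u v w y : E) (P : set E).

Lemma nbhs_prodR (S : set (E * R)) a : nbhs (a, 0 : R) S ->
  exists2 e : R, 0 < e & forall u s, `|a - u| < e -> `|s| < e -> S (u, s).
Proof.
move=> /nbhs_ballP[e /= e0 eS]; exists e => // u s ua se; apply: eS; split =>
  /=.
  by rewrite -ball_normE.
by rewrite -ball_normE /= sub0r normrN.
Qed.

Lemma norm_convex a y z (t e : R) : `|a - y| < e -> `|a - z| < e ->
  0 <= t <= 1 ->
  `|a - (y + t *: (z - y))| < e.
Proof.
move=> ay az /andP[t0 t1].
have -> : a - (y + t *: (z - y)) = (1 - t) *: (a - y) + t *: (a - z).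
  rewrite scalerBl scale1r -[RHS]addrA [- _ + _]addrC -scalerBr opprB.
  by rewrite [a - z + _]addrC subrKA -(opprB z y) scalerN opprD addrA.
apply: le_lt_trans (ler_normD _ _) _;
  rewrite !normrZ (ger0_norm t0) ger0_norm ?subr_ge0 //.
have [->|tn0] := eqVneq t 0; first by rewrite subr0 mul1r mul0r addr0.
have tp : 0 < t by rewrite lt_def tn0.
have := ler_wpM2l (_ : 0 <= 1 - t) (ltW ay); rewrite subr_ge0 => /(_ t1).
by have := az; rewrite -(ltr_pM2l tp); lra.
Qed.

(* Two points with [rho > 0] near [a] are joined inside [rho > 0] by moving both
   along [w] by a fixed amount and then following a segment. *)
Lemma superlevel_linked (rho : E -> R) a w (c : R) P :
  rho a = 0 -> {for a, continuous rho} -> 0 < c ->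
  (\forall p \near (a, 0 : R), 0 <= p.2 ->
     rho p.1 + c * p.2 <= rho (p.1 + p.2 *: w)) ->
  nbhs a P ->
  exists2 Q, nbhs a Q & forall y y', Q y -> Q y' -> 0 < rho y -> 0 < rho y' ->
    connected_component (P `&` [set x | 0 < rho x]) y y'.
Proof.
move=> ra cr c0 grow aP.
have [e e0 he] := nbhs_prodR (filterI grow (near_segment w aP)).
pose T := e / 2; have T0 : 0 < T by rewrite divr_gt0.
have Te : T < e by rewrite /T; lra.
(* Near [a] the value of [rho] exceeds [- (c * T)], so a displacement by [T *: w] makes it positive
   from any starting point there. *)
have /cvgrPdist_lt/(_ (c * T))/(_ (mulr_gt0 c0 T0)) := cr.
move=> /nbhs_ballP[e' /= e'0 hc].
pose d := Num.min e e'; have d0 : 0 < d by rewrite lt_min e0.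
exists (ball a d); first exact: nbhsx_ballx.
have inP u t : `|a - u| < d -> 0 <= t <= T -> P (u + t *: w).
  move=> + /andP[t0 tT]; rewrite lt_min => /andP[ue _].
  have [] := he u T ue; first by rewrite ger0_norm ?ltW.
  by move=> _ /(_ t); apply => /=; rewrite !ger0_norm // ltW.
have up u t : `|a - u| < d -> 0 <= t <= T -> rho u + c * t <= rho (u + t *: w).
  move=> + /andP[t0 tT]; rewrite lt_min => /andP[ue _].
  have [|/= h _] := he u t ue; first by rewrite ger0_norm // (le_lt_trans tT).
  exact: h.
have small u : `|a - u| < d -> - (c * T) < rho u.
  rewrite lt_min => /andP[_ ue]; have := hc u;
    rewrite -ball_normE /= ra sub0r normrN.
  by move=> /(_ ue); rewrite ltr_norml => /andP[].
have line u : continuous (fun t : R => u + t *: w).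
  by move=> t; apply: cvgD; [exact: cvg_cst | apply: cvgZr_tmp; exact: cvg_id].
pose A := P `&` [set x | 0 < rho x].
have vert u : `|a - u| < d -> 0 < rho u -> connected_component A u (u + T *: w).
  move=> ud ru; rewrite -{1}[u]addr0 -{1}(scale0r w).
  apply: (@path_connected_component R E (fun t => u + t *: w));
    [exact: ltW|exact: line|].
  move=> t tT; split; first exact: inP.
  apply: lt_le_trans (up _ _ ud tT); rewrite ltr_wpDr ?mulr_ge0 ?(ltW c0) //.
  by case/andP: tT.
move=> y y'; rewrite -ball_normE /= => yd y'd ry ry'.
apply: connected_component_trans (vert _ yd ry) _.
apply: connected_component_trans (connected_component_sym (vert _ y'd ry')).
(* The segment from [y] to [y'] may leave [0 < rho], but it stays in the ball by convexity, so its
   translate by [T *: w] lies in [0 < rho]. *)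
pose g (t : R) := (y + t *: (y' - y)) + T *: w.
have <- : g 0 = y + T *: w by rewrite /g scale0r addr0.
have <- : g 1 = y' + T *: w by rewrite /g scale1r [y + _]addrC subrK.
apply: path_connected_component => //.
  move=> t; apply: cvgD; last exact: cvg_cst.
  by apply: cvgD; [exact: cvg_cst | apply: cvgZr_tmp; exact: cvg_id].
move=> t t01; have zd := norm_convex yd y'd t01.
split; first by apply: inP => //; rewrite lexx ltW.
have := up _ T zd; rewrite lexx ltW // => /(_ isT); apply: lt_le_trans.
by have := small _ zd; lra.
Qed.

End Superlevel.

(** * An implicit function of one variable *)

Section Implicit.
Context {R : realType} {E : normedModType R}.
Implicit Types (F G : E -> R) (a u v w y : E) (P : set E).

(** Slope close to 1 makes [F] strictly increasing along [v] near [a]: the intermediate value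
    theorem gives a small zero on each line, and the slope estimate its uniqueness and its
    continuity in [u]. *)
Lemma implicit_function F a v : F a = 0 -> strict_slope F a v 1 ->
  (\forall u \near a, {for u, continuous F}) ->
  exists tau : E -> R, tau a = 0 /\ \forall u \near a,
    [/\ F (u + tau u *: v) = 0, {for u, continuous tau} & F u = 0 -> tau u = 0].
Proof.
move=> Fa sF cF.
have h20 : 0 < 2^-1 :> R by [].
have [e e0 he] := nbhs_prodR (filterI (sF _ h20) (near_segment v cF)).
have [e2 e20 he2] := nbhs_prodR (near_segment v (nbhsx_ballx a e e0)).
pose d := Num.min e2 (e / 2); have d0 : 0 < d by rewrite lt_min e20 divr_gt0.
have cont u t : `|a - u| < d -> `|t| < d -> {for u + t *: v, continuous F}.
  rewrite !lt_min => /andP[_ ue] /andP[_ te].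
  have [||_ /= /(_ t)] := he u t; [lra|lra|]; exact.
have slope u t t' : `|a - u| < d -> `|t| < d -> `|t'| < d ->
    `|F (u + t' *: v) - F (u + t *: v) - (t' - t)| <= 2^-1 * `|t' - t|.
  rewrite !lt_min => /andP[ue2 _] /andP[te2 te] /andP[_ t'e].
  have := he2 u t ue2 te2 t (lexx _); rewrite -ball_normE /= => ute.
  have [|+ _] := he _ (t' - t) ute.
    by apply: le_lt_trans (ler_normB _ _) _; lra.
  have -> : u + t *: v + (t' - t) *: v = u + t' *: v.
    by rewrite -addrA -scalerDl [t + _]addrC subrK.
  by rewrite mul1r.
pose T := d / 2; have T0 : 0 < T by rewrite divr_gt0.
have Td : T < d by rewrite /T; lra.
have T20 : 0 < T / 2 by rewrite divr_gt0.
have /cvgrPdist_lt/(_ _ T20)/nbhs_ballP[d' /= d'0 hd'] : {for a, continuous F}.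
  exact: nbhs_singleton cF.
pose r := Num.min d d'; have r0 : 0 < r by rewrite lt_min d0.
pose Z u := [set t : R | `|t| <= T /\ F (u + t *: v) = 0].
have ZT u t : Z u t -> `|t| < d by move=> [tT _]; exact: le_lt_trans Td.
have Zuniq u t t' : `|a - u| < d -> Z u t -> Z u t' -> t' = t.
  move=> ud zt zt'; have := slope u t t' ud (ZT _ _ zt) (ZT _ _ zt').
  rewrite zt.2 zt'.2 subrr sub0r normrN => h; apply/eqP;
    rewrite -subr_eq0 -normr_le0; lra.
pose tau u := xget 0 (Z u).
have Ztau u : `|a - u| < r -> Z u (tau u).
  rewrite lt_min => /andP[ud ud'].
  (* With slope at least 1/2 along [v], this bound forces [F] to be positive at [u + T *: v] and
     negative at [u - T *: v]. *)
  have Fu : `|F u| < T / 2.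
    have := hd' u; rewrite -ball_normE /= Fa sub0r normrN; exact.
  have Td' : `|T| < d by rewrite gtr0_norm.
  have NTd' : `|- T| < d by rewrite normrN.
  have z0 : `|0 : R| < d by rewrite normr0.
  have up := slope u 0 T ud z0 Td'; have dn := slope u 0 (- T) ud z0 NTd'.
  move: up dn; rewrite scale0r addr0 !subr0 normrN (gtr0_norm T0) !ler_norml.
  move: Fu; rewrite ltr_norml => /andP[Fu1 Fu2] /andP[up _] /andP[_ dn].
  have cg : {within `[- T, T], continuous (fun t : R => F (u + t *: v))}.
    apply: continuous_in_subspaceT => t;
      rewrite inE /= in_itv /= -ler_norml => tT.
    apply: (@continuous_comp _ _ _ (fun t : R => u + t *: v) F); last first.
      exact: cont (le_lt_trans tT Td).
    by apply: cvgD; [exact: cvg_cst | apply: cvgZr_tmp; exact: cvg_id].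
  have [||t tT Ft] := @IVT R _ (- T) T 0 _ cg; first by lra.
    by rewrite ge_min le_max; apply/andP; split; apply/orP; [left|right]; lra.
  rewrite /tau; case: xgetP => [s -> //|/(_ t)[]].
  by split => //; rewrite ler_norml; move: tT; rewrite in_itv.
have rd u : `|a - u| < r -> `|a - u| < d by rewrite lt_min => /andP[].
exists tau; split.
  apply: (Zuniq a); rewrite ?subrr ?normr0 //; last by apply: Ztau;
    rewrite subrr normr0.
  by split; rewrite ?normr0 ?ltW // scale0r addr0.
apply/nbhs_ballP; exists r => //= u; rewrite -ball_normE /= => ur.
have zu := Ztau u ur; split; first exact: zu.2.
  apply/cvgrPdist_lt => /= eps eps0.
  (* The slope estimate bounds [|tau u' - tau u|] by twice [|F (u' + tau u *: v)|], which tends to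
     zero as [u'] tends to [u]. *)
  have cFu : (fun u' => F (u' + tau u *: v)) @ u --> F (u + tau u *: v).
    apply: (@continuous_comp _ _ _ (fun u' => u' + tau u *: v) F).
      by apply: cvgD; [exact: cvg_id | exact: cvg_cst].
    exact: cont (rd _ ur) (ZT _ _ zu).
  have eps20 : 0 < eps / 2 by rewrite divr_gt0.
  have /cvgrPdist_lt/(_ _ eps20) n1 := cFu.
  have n2 : nbhs u (ball a r).
    by apply: open_nbhs_nbhs; split; [exact: ball_open|rewrite -ball_normE].
  apply: (filterS _ (filterI n1 n2)) => u' [];
    rewrite -ball_normE /= zu.2 sub0r normrN.
  move=> h u'r; have zu' := Ztau u' u'r.
  have := slope u' (tau u) (tau u') (rd _ u'r) (ZT _ _ zu) (ZT _ _ zu').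
  rewrite zu'.2 sub0r [`|tau u - _|]distrC => h'.
  have := ler_normD (- F (u' + tau u *: v) - (tau u' - tau u)) (F (u' + tau u
    *: v)).
  rewrite addrAC addNr add0r normrN; lra.
move=> Fu; apply: (Zuniq u) => //; first exact: rd.
by split; rewrite ?normr0 ?ltW // scale0r addr0.
Qed.

End Implicit.

Lemma connected_component_image (T U : topologicalType) (f : T -> U)
    (A : set T) (B : set U) x y :
  (forall z, A z -> {for z, continuous f}) -> (forall z, A z -> B (f z)) ->
  connected_component A x y -> connected_component B (f x) (f y).
Proof.
move=> cf AB [S [Sx SA cS] Sy]; exists (f @` S); last by exists y.
split; first by exists x.
  by move=> _ [z Sz <-]; exact/AB/SA.
apply: connected_continuous_connected => //.
by apply: continuous_in_subspaceT => z; rewrite inE => /SA/cf.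
Qed.

(** * Linking points of a hyperface near a corner *)

Section Corner.
Context {R : realType} {E : normedModType R}.
Implicit Types (F G : E -> R) (a u v w y : E) (P : set E).

(* [F = 0] is a graph over its tangent space in the direction [v]; the
   retraction [Phi] along [v] onto it carries the superlevel set [G \o Phi >
     0] onto
   [F = 0 < G]. *)
Lemma level_superlevel_linked F G a v w P : F a = 0 -> G a = 0 ->
  strict_slope F a v 1 -> strict_slope F a w 0 ->
  strict_slope G a v 0 -> strict_slope G a w 1 ->
  (\forall u \near a, {for u, continuous F}) -> {for a, continuous G} ->
  nbhs a P ->
  exists2 Q, nbhs a Q & forall y y', Q y -> Q y' -> F y = 0 -> F y' = 0 ->
    0 < G y -> 0 < G y' ->
    connected_component (P `&` [set x | F x = 0 /\ 0 < G x]) y y'.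
Proof.
move=> Fa Ga Fv Fw Gv Gw cF cG aP.
have [tau [taua taunear]] := implicit_function Fa Fv cF.
pose Phi u := u + tau u *: v; pose rho u := G (Phi u).
have Phia : Phi a = a by rewrite /Phi taua scale0r addr0.
have [_ tau_cont _] := nbhs_singleton taunear.
have ctau : tau @ a --> (0 : R) by rewrite -taua; exact: tau_cont.
have Phi_cont u : {for u, continuous tau} -> {for u, continuous Phi}.
  by move=> ct; apply: cvgD; [exact: cvg_id | exact: cvgZr_tmp].
have cPhi : Phi @ a --> a by rewrite -[X in _ --> X]Phia; exact: Phi_cont.
have crho : {for a, continuous rho}.
  by apply: (@continuous_comp _ _ _ Phi G); [exact: Phi_cont | rewrite Phia].
have c1 : (fun p : E * R => p.1) @ (a, 0 : R) --> a by exact: cvg_fst.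
have c2 : (fun p : E * R => p.2) @ (a, 0 : R) --> (0 : R) by exact: cvg_snd.
have c12 : (fun p : E * R => p.1 + p.2 *: w) @ (a, 0 : R) --> a.
  exact: cvg_add_scale.
have cP1 : (fun p : E * R => Phi p.1) @ (a, 0 : R) --> a.
  exact: (cvg_comp _ _ c1 cPhi).
have cP12 : (fun p : E * R => Phi p.1 + p.2 *: w) @ (a, 0 : R) --> a.
  exact: cvg_add_scale.
have ct : (fun p : E * R => tau (p.1 + p.2 *: w) - tau p.1) @ (a,
  0 : R) --> (0 : R).
  rewrite -[X in _ --> X](subr0 0); apply: cvgB.
    exact: (cvg_comp _ _ c12 ctau).
  exact: (cvg_comp _ _ c1 ctau).
have half0 : 0 < 2^-1 :> R by [].
have q0 : 0 < 4^-1 :> R by [].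
have n1 := strict_slope_near Fv cP12 ct q0.
have n2 := strict_slope_near Gv cP12 ct q0.
have n3 := strict_slope_near Fw cP1 c2 q0.
have n4 := strict_slope_near Gw cP1 c2 q0.
have Fz : \forall u \near a, F (Phi u) = 0 by apply: (filterS _ taunear) =>
  u [].
have n5 : \forall p \near (a, 0 : R), F (Phi p.1) = 0 by exact: c1 _ Fz.
have n6 : \forall p \near (a, 0 : R), F (Phi (p.1 + p.2 *: w)) = 0
  by exact: c12 _ Fz.
(* Both retracted points lie on [F = 0], so the slopes of [F] bound the change [z] of [tau] by
   [s / 2]. Then [G] gains at least [s - s / 4 - |z| / 4], which exceeds the required [s / 2] when
   [s > 0]. *)
have grow : \forall p \near (a, 0 : R), 0 <= p.2 ->
    rho p.1 + 2^-1 * p.2 <= rho (p.1 + p.2 *: w).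
  apply: (filterS _ (filterI (filterI (filterI n1 n2) (filterI n3 n4))
    (filterI n5 n6))).
  move=> [u s] /= [[[h1 h2] [h3 h4]] [F0 F0']] s0.
  have PhiE : Phi u + s *: w + (tau (u + s *: w) - tau u) *: v = Phi (u + s *:
    w).
    by rewrite /Phi scalerBl (addrAC u) -[LHS]addrA (addrC (tau u *: v)) subrK.
  move: h1 h2 h3 h4; rewrite PhiE -/(Phi _) /rho F0 F0' (ger0_norm s0).
  set x := F _; set y := G (Phi u + _); set z := tau _ - _.
  rewrite !mul1r !mul0r !subr0 !sub0r.
  rewrite !ler_norml => /andP[a1 a2] /andP[b1 b2] /andP[c3 c4] /andP[d1 d2].
  have nz : `|z| <= 2^-1 * s.
    by case: (ger0P z) a1 a2 => z0; lra.
  lra.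
pose P' := [set u | [/\ F (Phi u) = 0, {for u, continuous tau} & P (Phi u)]].
have aP' : nbhs a P'.
  apply: (filterS _ (filterI taunear (cPhi _ aP))) => u [[h1 h2 _] h3].
  by split.
have rhoa : rho a = 0 by rewrite /rho Phia.
have [Q aQ Qlink] := superlevel_linked rhoa crho half0 grow aP'.
exists (Q `&` [set u | F u = 0 -> tau u = 0]).
  by apply: filterI => //; apply: (filterS _ taunear) => u [].
move=> y y' [Qy ty] [Qy' ty'] /[dup] Fy /ty ty0 /[dup] Fy' /ty' ty'0 Gy Gy'.
(* Points of [F = 0] near [a] are fixed by the retraction, so a connected set joining them in
   [0 < rho] is mapped to one joining them in [F = 0 < G]. *)
have Phiy : Phi y = y by rewrite /Phi ty0 scale0r addr0.
have Phiy' : Phi y' = y' by rewrite /Phi ty'0 scale0r addr0.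
rewrite -Phiy -Phiy'.
apply: (@connected_component_image _ _ Phi (P' `&` [set x | 0 < rho x])).
- by move=> z [[_ cz _] _]; exact: Phi_cont.
- by move=> z [[? _ ?] ?].
by apply: Qlink => //; rewrite /rho (Phiy, Phiy').
Qed.

End Corner.

Section DualPair.
Context {R : realType} {E : normedModType R}.
Implicit Types (F G : E -> R) (a v w : E).

Lemma strict_slopeZ F a v A k : strict_slope F a v A ->
  strict_slope F a (k *: v) (k * A).
Proof.
move=> sA; rewrite -[k *: v]addr0 -[k * A]addr0; apply: strict_slope_comb =>
  // e e0.
by near=> p; rewrite scaler0 addr0 subrr mul0r subr0 normr0 mulr_ge0 // ltW.
Unshelve. all: by end_near. Qed.

(** Cramer's rule: independence provides [v0] and [w0] with nonzero determinant [ka], and the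
    coefficients of [v] and [w] are those of the inverse 2 by 2 matrix. *)
Lemma dual_pair F G a (DF DG : E -> R) :
  (forall v, strict_slope F a v (DF v)) -> (forall v,
    strict_slope G a v (DG v)) ->
  (forall c d, (forall v, c * DF v + d * DG v = 0) -> c = 0 /\ d = 0) ->
  exists v w, [/\ strict_slope F a v 1, strict_slope F a w 0,
                  strict_slope G a v 0 & strict_slope G a w 1].
Proof.
move=> sF sG indep.
have [v0 v00] : exists v, DF v != 0.
  apply: contrapT => h; suff [/eqP] : 1 = 0 :> R /\ 0 = 0 :> R
    by rewrite oner_eq0.
  apply: indep => v; rewrite mul0r addr0 mul1r.
  by apply/eqP; apply: contra_notT h => ?; exists v.
set al := DF v0 in v00; set be := DG v0.
(* If every such determinant vanished, [- be] and [al] would be the coefficients of a dependence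
   relation, although [al] is nonzero. *)
have [w0 w00] : exists w, al * DG w - be * DF w != 0.
  apply: contrapT => h; suff [_ E0] : - be = 0 /\ al = 0
    by rewrite E0 eqxx in v00.
  apply: indep => w; rewrite addrC mulNr.
  by apply/eqP; apply: contra_notT h => ?; exists w.
set ka := al * DG w0 - be * DF w0 in w00.
have slope (H : E -> R) (D : E -> R) (x y : R) : (forall v,
  strict_slope H a v (D v)) ->
    strict_slope H a (x *: v0 + y *: w0) (x * D v0 + y * D w0).
  by move=> sH; apply: strict_slope_comb => //; exact: strict_slopeZ.
pose v := (DG w0 / ka) *: v0 + (- be / ka) *: w0.
pose w := (- DF w0 / ka) *: v0 + (al / ka) *: w0.
have := slope F DF (DG w0 / ka) (- be / ka) sF.
have := slope G DG (DG w0 / ka) (- be / ka) sG.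
have := slope F DF (- DF w0 / ka) (al / ka) sF.
have := slope G DG (- DF w0 / ka) (al / ka) sG.
rewrite -/al -/be -/v -/w.
have -> : - DF w0 / ka * be + al / ka * DG w0 = 1
  by rewrite -(divff w00) /ka; ring.
have -> : - DF w0 / ka * al + al / ka * DF w0 = 0 by ring.
have -> : DG w0 / ka * be + - be / ka * DG w0 = 0 by ring.
have -> : DG w0 / ka * al + - be / ka * DF w0 = 1
  by rewrite -(divff w00) /ka; ring.
by move=> h1 h2 h3 h4; exists v, w.
Qed.

End DualPair.

(** * Faces of a manifold with corners *)

Section Corners.
Context {R : realType} {n : nat} (X : manifoldWithCorners R n).
Local Notation N := (nb_hyperfaces X).
Local Notation r := (rdef X).

Section InChart.
Variable phi : chart R n (ambient X).
Hypothesis phiA : @atlas _ _ (ambient X) phi.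
Local Notation V := (phi @` chart_dom phi).
Let rho (k : 'I_N) := r k \o chart_inv phi.

Lemma nbhs_chart_img u : V u -> nbhs u V.
Proof. by move=> Vu; apply: open_nbhs_nbhs; split => //;
  exact: chart_img_open. Qed.

Lemma local_rdef_continuous k u : V u -> {for u, continuous (rho k)}.
Proof. by move=> Vu; have [+ _] := rdef_smooth k phiA 0%N; apply;
  rewrite inE. Qed.

Lemma local_rdef_slope k u v : V u -> strict_slope (rho k) u v ('D_v (rho k) u).
Proof.
move=> Vu; have [_ /(_ v)[dV [cV _]]] := rdef_smooth k phiA 1%N.
apply: C1_strict_slope; first exact: filterS (nbhs_chart_img Vu).
by apply: cV; rewrite inE.
Qed.

End InChart.

Lemma rdef_continuous k : continuous (r k).
Proof.
move=> x; have [phi phiA phix] := atlas_cover x.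
have Vx : (phi @` chart_dom phi) (phi x) by exists x.
have cx : phi @ x --> phi x by apply: chart_map_continuous; rewrite inE.
have := cvg_comp _ _ cx (local_rdef_continuous phiA Vx (k := k)).
rewrite /= chart_mapK ?inE //; apply: cvg_trans.
apply: near_eq_cvg; near=> y; rewrite /= chart_mapK // inE.
near: y; apply: open_nbhs_nbhs; split => //; exact: chart_dom_open.
Unshelve. all: by end_near. Qed.

Definition zeros (x : ambient X) : {set 'I_N} := [set j | r j x == 0]%SET.

Lemma near_zeros x : body X x -> \forall y \near x, forall k,
  k \notin zeros x -> 0 < r k y.
Proof.
move=> bx; apply: filter_forall => k.
have [kx|kx] := boolP (k \in zeros x); first exact: nearW.
have rx : 0 < r k x by move: kx; rewrite inE lt_def => ->; exact: bx.
have /cvgrPdist_lt/(_ _ rx) := @rdef_continuous k x.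
apply: filterS => y h _; move: h; rewrite ltr_norml; lra.
Qed.

Lemma near_zeros_subset x : body X x -> \forall y \near x,
  zeros y \subset zeros x.
Proof.
move=> /near_zeros; apply: filterS => y h; apply/fintype.subsetP => k ky.
by apply: contraLR ky => /h; rewrite inE; exact: lt0r_neq0.
Qed.

(** Near a point the set of vanishing indices can only shrink; its cardinal is fixed on a stratum,
    so it is locally constant there. *)
Lemma zeros_constant p (g : set (ambient X)) : connected g ->
  g `<=` stratum p ->
  forall y z, g y -> g z -> zeros y = zeros z.
Proof.
move=> cg gp y z gy gz.
pose U I := interior [set x : ambient X | stratum p x -> zeros x = I].
have UP x : stratum p x -> U (zeros x) x.
  move=> [bx cx]; apply: (filterS _ (near_zeros_subset bx)) => t tx [_ ct].
  have E : #|zeros x| = #|zeros t| by rewrite [LHS]cx [RHS]ct.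
  by apply/eqP; rewrite eqEcard tx E leqnn.
have UE I x : stratum p x -> U I x -> zeros x = I.
  by move=> sx /interior_subset /(_ sx).
suff E : g `&` [set x | zeros x = zeros y] = g.
  by have [_ ->] : (g `&` [set x | zeros x = zeros y]) z by rewrite E.
apply: cg; first by exists y.
  exists (U (zeros y)); first exact: open_interior.
  apply/seteqP; split=> x [gx] /= h; split => //; first by rewrite -h;
    exact/UP/gp.
  by apply: UE => //; exact: gp.
exists (~` \bigcup_(I in [set I | I != zeros y]) U I).
  by apply: open_closedC; apply: bigcup_open => I _; exact: open_interior.
apply/seteqP; split=> x [gx] /= h; split => //.
  by move=> [I /= /eqP nI UI]; apply: nI; rewrite -h (UE I x) //; exact: gp.
by apply: contrapT => nx; apply: h; exists (zeros x); [exact/eqP | exact/UP/gp].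
Qed.

Lemma stratum_signs (J : {set 'I_N}) (z : ambient X) :
  (forall k, k \in J -> r k z = 0) -> (forall k, k \notin J -> 0 < r k z) ->
  stratum #|J| z.
Proof.
move=> zJ pJ; split=> [k|].
  by have [/zJ->|/pJ/ltW] := boolP (k \in J).
congr #|pred_of_set _|; apply/setP => k; rewrite inE.
have [/zJ->|/pJ/lt0r_neq0/negbTE//] := boolP (k \in J); exact: eqxx.
Qed.

Lemma chart_linked (phi : chart R n (ambient X)) (A : set 'rV[R]_n) p y y' :
  A `<=` phi @` chart_dom phi -> (forall z, A z ->
    stratum p (chart_inv phi z)) ->
  chart_dom phi y -> chart_dom phi y' ->
  connected_component A (phi y) (phi y') ->
    connected_component (stratum p) y y'.
Proof.
move=> AV As dy dy' /connected_component_image - /(_ _ (chart_inv phi)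
  (stratum p)).
rewrite !chart_mapK ?inE //; apply => // z /AV Vz.
by apply: chart_inv_continuous; rewrite inE.
Qed.

(** Exactly one index [j] vanishes at [x] but is not in [J]. In a chart the points in question
    satisfy [r_j > 0] if [J] is empty, and [r_i = 0 < r_j] if [J] is the singleton of [i];
    independence of the differentials supplies the directions for the two linking lemmas. *)
Lemma local_linked x (J : {set 'I_N}) : body X x -> J \subset zeros x ->
  #|zeros x| = #|J|.+1 -> (#|J| <= 1)%N ->
  exists2 Q, nbhs x Q & forall y y', Q y -> Q y' -> body X y -> body X y' ->
    zeros y = J -> zeros y' = J -> connected_component (stratum #|J|) y y'.
Proof.
move=> bx Jx cx cJ; have [phi phiA phix] := atlas_cover x.
have Vx : (phi @` chart_dom phi) (phi x) by exists x.
pose psi := chart_inv phi; pose rho k := r k \o psi; pose a := phi x.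
have rhoE k y : chart_dom phi y -> rho k (phi y) = r k y.
  by move=> dy; rewrite /rho /psi /= chart_mapK // inE.
(* On [P] the functions that do not vanish at [x] stay positive, so only those vanishing at [x]
   remain to be controlled. *)
pose P := [set u | (phi @` chart_dom phi) u /\ forall k, k \notin zeros x ->
  0 < rho k u].
have aP : nbhs a P.
  apply: filterI; first exact: nbhs_chart_img.
  have cpsi : psi @ a --> x.
    rewrite -[x in _ --> x](@chart_mapK _ _ _ phi) ?inE //.
    by apply: chart_inv_continuous; rewrite inE.
  exact: cpsi (near_zeros bx).
have indep (c : 'I_N -> R) :
    (forall v, \sum_(j in zeros x) c j * 'D_v (rho j) a = 0) ->
    forall j, j \in zeros x -> c j = 0.
  apply: (rdef_independent (J := zeros x) (x := x)) => // j.
  by rewrite inE => /eqP.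
have zx k : k \in zeros x -> rho k a = 0 by rewrite rhoE // inE => /eqP.
have phi_near Q : nbhs a Q -> nbhs x (chart_dom phi `&` phi @^-1` Q).
  move=> aQ; apply: filterI.
    by apply: open_nbhs_nbhs; split => //; exact: chart_dom_open.
  by apply: (@chart_map_continuous _ _ _ phi x) => //; rewrite inE.
have pos_notin k y : body X y -> zeros y = J -> k \notin J -> 0 < r k y.
  by move=> yb <-; rewrite inE lt_def => ->; exact: yb.
have zero_in k y : zeros y = J -> k \in J -> r k y = 0.
  by move=> <-; rewrite inE => /eqP.
have slope k v : strict_slope (rho k) a v ('D_v (rho k) a)
  by exact: local_rdef_slope.
have crho k u : (phi @` chart_dom phi) u -> {for u, continuous (rho k)}.
  exact: local_rdef_continuous.
have [j zJ jJ] : exists2 j, zeros x = (j |: J)%SET & j \notin J.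
  have /cards1P[j jE] : #|zeros x :\: J| == 1%N.
    by rewrite cardsD (finset.setIidPr Jx) cx subSnn.
  have : j \in (zeros x :\: J)%SET by rewrite jE set11.
  rewrite finset.in_setD => /andP[jJ jx]; exists j => //; apply/eqP;
    rewrite eq_sym eqEcard.
  by rewrite finset.subUset finset.sub1set jx Jx cx cardsU1 jJ add1n leqnn.
have [J0|[i iJ]] := set_0Vmem J.
  have zj : zeros x = [set j]%SET by rewrite zJ J0 finset.setU0.
  have [v v0] : exists v, 'D_v (rho j) a != 0.
    apply: contrapT => h.
    have H v : \sum_(k in zeros x) 1 * 'D_v (rho k) a = 0.
      rewrite zj finset.big_set1 mul1r.
      by apply/eqP; apply: contra_notT h => ?; exists v.
    have jz : j \in zeros x by rewrite zj set11.
    by have /eqP := indep (fun=> 1) H j jz; rewrite oner_eq0.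
  have := strict_slopeZ ('D_v (rho j) a)^-1 (slope j v); rewrite mulVf // => sj.
  have half0 : 0 < 2^-1 :> R by [].
  have grow : \forall p \near (a, 0 : R), 0 <= p.2 ->
      rho j p.1 + 2^-1 * p.2 <= rho j (p.1 + p.2 *: (('D_v (rho j) a)^-1 *: v)).
    apply: (filterS _ (sj _ half0)) => p /= + p0.
    by rewrite mul1r (ger0_norm p0) ler_norml => /andP[]; lra.
  have ja : rho j a = 0 by apply: zx; rewrite zj set11.
  have [Q aQ Qlink] := superlevel_linked ja (crho j a Vx) half0 grow aP.
  exists (chart_dom phi `&` phi @^-1` Q); first exact: phi_near.
  move=> y y' [dy Qy] [dy' Qy'] yb y'b zy zy'.
  apply: chart_linked (dy) (dy') (Qlink _ _ Qy Qy' _ _).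
  - by move=> z [[]].
  - move=> z [[Vz Pz] /= jz]; apply: stratum_signs => k; first
      by rewrite J0 inE.
    by move=> _; have [->|kj] := eqVneq k j; [|apply: Pz; rewrite zj inE].
  - by rewrite rhoE //; exact: (pos_notin _ _ yb zy jJ).
  - by rewrite rhoE //; exact: (pos_notin _ _ y'b zy' jJ).
have Ji : J = [set i]%SET.
  by apply/esym/eqP; rewrite eqEcard finset.sub1set iJ cards1.
have ji : j != i by move: jJ; rewrite Ji inE.
have zi : i \in zeros x by apply: (fintype.subsetP Jx).
have zj : j \in zeros x by rewrite zJ setU11.
have [v [w [Fv Fw Gv Gw]]] : exists v w, [/\ strict_slope (rho i) a v 1,
    strict_slope (rho i) a w 0, strict_slope (rho j) a v 0 &
      strict_slope (rho j) a w 1].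
  apply: (dual_pair (slope i) (slope j)) => c d cd.
  pose e k := if k == i then c else d.
  have H v : \sum_(k in zeros x) e k * 'D_v (rho k) a = 0.
    rewrite zJ Ji big_setU1 ?inE //= finset.big_set1 /e eqxx (negbTE ji) addrC.
    exact: cd.
  have := indep e H i zi; have := indep e H j zj.
  by rewrite /e eqxx (negbTE ji).
have cF : \forall u \near a, {for u, continuous (rho i)}.
  by apply: (filterS _ (nbhs_chart_img Vx)) => u; exact: crho.
have [Q aQ Qlink] :=
  level_superlevel_linked (zx i zi) (zx j zj) Fv Fw Gv Gw cF (crho j a Vx) aP.
exists (chart_dom phi `&` phi @^-1` Q); first exact: phi_near.
move=> y y' [dy Qy] [dy' Qy'] yb y'b zy zy'.
apply: chart_linked (dy) (dy') (Qlink _ _ Qy Qy' _ _ _ _).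
- by move=> z [[]].
- move=> z [[Vz Pz] /= [iz jz]]; apply: stratum_signs => k; first
    by rewrite Ji inE => /eqP->.
  move=> kJ; have [->//|kj] := eqVneq k j; apply: Pz.
  by rewrite zJ in_setU1 negb_or kj.
- by rewrite rhoE //; exact: (zero_in _ _ zy iJ).
- by rewrite rhoE //; exact: (zero_in _ _ zy' iJ).
- by rewrite rhoE //; exact: (pos_notin _ _ yb zy jJ).
- by rewrite rhoE //; exact: (pos_notin _ _ y'b zy' jJ).
Qed.

End Corners.

(** * The boundary of a generator *)

Section BoundaryForm.
Context {R : realType} {n : nat} {X : manifoldWithCorners R n}.
Local Notation N := (nb_hyperfaces X).

Lemma face_nonempty p (g : face X p) : exists y, val g y.
Proof.
by have [x sx ->] := set_valP g; exists x; exact: connected_component_refl.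
Qed.

Lemma face_subset p (g : face X p) : val g `<=` stratum p.
Proof. by have [x sx ->] := set_valP g; exact: connected_component_sub. Qed.

Lemma faceE p (g : face X p) y : val g y ->
  val g = connected_component (stratum p) y.
Proof. by have [x sx ->] := set_valP g; exact: same_connected_component. Qed.

Lemma face_index_zeros p (g : face X p) y : val g y ->
  face_index (val g) = zeros y.
Proof.
move=> gy; have cg : connected (val g) by rewrite (faceE gy);
  exact: component_connected.
apply/setP => k; rewrite !inE; apply/asboolP/eqP => [/(_ y gy)//|ky z gz /=].
have : k \in zeros y by rewrite inE ky.
by rewrite (zeros_constant cg (@face_subset p g) gy gz) inE => /eqP.
Qed.

Lemma card_face_index p (g : face X p) : #|face_index (val g)| = p.
Proof.
have [y gy] := face_nonempty g; rewrite (face_index_zeros gy).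
by have [_] := face_subset gy.
Qed.

Lemma incident_index_subset p (f : face X p.+1) (g : face X p) :
  incident f g -> face_index (val g) \subset face_index (val f).
Proof.
move=> fg; have [x fx] := face_nonempty f; have [bx _] := face_subset fx.
have [y [gy yx]] := fg x fx _ (near_zeros_subset bx).
by rewrite (face_index_zeros gy) (face_index_zeros fx).
Qed.

(** Both faces meet every neighbourhood of a point of [f]; by [local_linked] nearby points with this
    index set lie in one component of the stratum. *)
Lemma incident_unique p (f : face X p.+1) (g g' : face X p) : (p <= 1)%N ->
  incident f g -> incident f g' ->
    face_index (val g) = face_index (val g') -> g = g'.
Proof.
move=> p1 fg fg' gg'; have [x fx] := face_nonempty f.
have [bx cx] := face_subset fx.
have fI := face_index_zeros fx; have cg := card_face_index g.
have [||| Q xQ Qlink] := @local_linked _ _ X x (face_index (val g)) bx.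
- by rewrite -fI; exact: incident_index_subset.
- by rewrite -fI !card_face_index.
- by rewrite cg.
have [y [gy Qy]] := fg x fx _ xQ; have [y' [gy' Qy']] := fg' x fx _ xQ.
have [[yb _] [y'b _]] := (face_subset gy, face_subset gy').
have := Qlink y y' Qy Qy' yb y'b;
  rewrite cg gg' -(face_index_zeros gy) -(face_index_zeros gy').
move=> /(_ gg' erefl) yy'; apply: val_inj.
by rewrite (faceE gy) (faceE gy'); exact: same_connected_component.
Qed.

(** The exponent of the sign in [contract_basis], so ranks start at 0. *)
Definition rank_in (I : {set 'I_N}) (i : 'I_N) : nat :=
  #|[set k in I | (k < i)%N]%SET|.

Lemma rank_in_lt (I : {set 'I_N}) (i j : 'I_N) : i \in I -> (i < j)%N ->
  (rank_in I i < rank_in I j)%N.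
Proof.
move=> iI ij; apply: proper_card; apply/properP; split.
  by apply/fintype.subsetP => k; rewrite !inE => /andP[-> /= /ltn_trans]; exact.
by exists i; rewrite !inE ?iI ?ij ?ltnn ?andbF.
Qed.

Lemma rank_in_inj (I : {set 'I_N}) : {in I &, injective (rank_in I)}.
Proof.
move=> i j iI jI E; apply/eqP; rewrite -val_eqE /=; apply: contraT.
by rewrite neq_ltn => /orP[/(rank_in_lt iI)|/(rank_in_lt jI)]; rewrite E ltnn.
Qed.

Lemma rank_in_card (I : {set 'I_N}) i : i \in I -> (rank_in I i < #|I|)%N.
Proof.
move=> iI; apply: proper_card; apply/properP; split.
  by apply/fintype.subsetP => k; rewrite inE => /andP[].
by exists i; rewrite // inE ltnn andbF.
Qed.

(** The nested index sets differ in cardinal by one, so a single index [i] is lost, and contraction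
    by it leaves only a sign. *)
Lemma symbol_contract_lost p (f : face X p.+1) (g : face X p) : incident f g ->
  exists i, [/\ i \in face_index (val f),
    face_index (val g) = (face_index (val f) :\ i)%SET &
    symbol g (contract_lost (val g) (val f) (conormal_basis (val f))) =
    << (-1) ^+ rank_in (face_index (val f)) i *g g >>].
Proof.
move=> /incident_index_subset gf.
have /cards1P[i iE] : #|face_index (val f) :\: face_index (val g)| == 1%N.
  by rewrite cardsD (finset.setIidPr gf) !card_face_index subSnn.
have : i \in (face_index (val f) :\: face_index (val g))%SET
  by rewrite iE set11.
rewrite finset.in_setD => /andP[ig i_f].
have gE : face_index (val g) = (face_index (val f) :\ i)%SET.
  apply/eqP; rewrite eqEcard finset.subsetD1 gf ig /= -(leq_add2l 1).
  by have := cardsD1 i (face_index (val f)); rewrite i_f => <-;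
    rewrite !card_face_index add1n.
exists i; split => //; rewrite /contract_lost /lost_index iE.
case: pickP => [k|/(_ i)]; last by rewrite inE eqxx.
rewrite inE => /eqP ->; rewrite contract_ext_basis /contract_basis i_f -gE.
rewrite /symbol; congr << _ *g _ >>.
rewrite -/(rank_in _ i) -signr_odd; case: (odd _).
  by rewrite expr1 mulrN1z !ffunE eqxx.
by rewrite expr0 mulr1z ffunE eqxx.
Qed.

(** With at most two indices the ranks are 0 and 1, so the sign determines the lost index and then,
    by [incident_unique], the face: each sign occurs at most once. *)
Lemma symbol_boundary_edge p (f : face X p.+1) : (p <= 1)%N ->
  exists u v, delta << 1 *g f >> = freeg_option u - freeg_option v :> chain X p.
Proof.
move=> p1; pose I := face_index (val f).
have cI : #|I| = p.+1 by exact: card_face_index.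
pose F (g : face X p) : chain X p :=
  symbol g (contract_lost (val g) (val f) (conormal_basis (val f))).
have dE : delta << 1 *g f >> = \sum_(g \in incident f) F g.
  by rewrite -symbol_basis delta_symbol //; left.
(* The incident faces are sorted by sign, [false] for [+1] and [true] for [-1]; a sign that does not
   occur gives the vertex [None]. *)
pose A (b : bool) :=
  [set g : face X p | incident f g /\ F g = << (-1) ^+ b *g g >>].
have sign_inj (b c : bool) (g : face X p) :
    << (-1) ^+ b *g g >> = << (-1) ^+ c *g g >> :> chain X p -> b = c.
  by move=> /(congr1 (coeff g)); rewrite !coeffU eqxx !mulr1; case: b c =>
    [] [].
have AP b g : A b g -> exists i,
    [/\ i \in I, face_index (val g) = (I :\ i)%SET & rank_in I i = b :> nat].
  move=> [fg Fg]; have [i [iI gE Fg']] := symbol_contract_lost fg.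
  exists i; split => //; have := rank_in_card iI; rewrite -/I cI =>
    /leq_trans /(_ (p1 : p.+1 <= 2)%N).
  have : odd (rank_in I i) = b.
    by apply: (sign_inj _ _ g); rewrite signr_odd -Fg' -Fg.
  by case: (rank_in I i) => [|[]] //= <-.
have Auniq b g g' : A b g -> A b g' -> g = g'.
  move=> /[dup] -[fg _] /AP[i [iI gE ri]] /[dup] -[fg' _] /AP[j [jI g'E rj]].
  apply: incident_unique fg fg' _ => //; rewrite gE g'E; congr (_ :\ _)%SET.
  by apply: (rank_in_inj iI jI); rewrite ri rj.
have Asum b : exists u, finite_set (A b) /\
    \sum_(g \in A b) F g = freeg_option u *~ (-1) ^+ b.
  have [[g Ag]|nA] := pselect (exists g, A b g).
    have -> : A b = [set g].
      by apply/seteqP; split => [g' /Auniq|_ ->//]; apply.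
    exists (Some g); rewrite fsbig_set1; split => //=.
    by have [_ ->] := Ag; rewrite freegUz.
  have -> : A b = set0 by apply/seteqP; split => // g Ag; case: nA; exists g.
  by exists None; rewrite fsbig_set0 mul0rz; split.
have AU : incident f = A false `|` A true.
  apply/seteqP; split => [g fg|g [] []//].
  have [i [iI gE Fg]] := symbol_contract_lost fg.
  have : F g = << (-1) ^+ odd (rank_in I i) *g g >> by rewrite signr_odd.
  by case: (odd _) => ?; [right|left].
have [u [fu uE]] := Asum false; have [v [fv vE]] := Asum true.
exists u, v; rewrite dE AU fsbigU0 //; last first.
  by move=> g [[_ Fg] [_]]; rewrite Fg => /sign_inj.
by rewrite uE vE expr0 expr1 mulr1z mulrN1z.
Qed.

End BoundaryForm.

Theorem theorem4p6 (R : realType) (n : nat) (X : manifoldWithCorners R n)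
    (d : nat) :
  connected (body X) -> is_codimension X d -> (d <= 2)%N ->
  free_abelian (pcn_homology0 X) /\ free_abelian (pcn_homology1 X).
Proof.
move=> _ [_ codim] d2.
have H p : embeds_in_free (conormal_homology X p).
  have [|q [qB qker]] := @graph_cokernel _ _ (@delta _ _ X p.+1).
    move=> f; have [p1|p1] := leqP p 1%N; first exact: symbol_boundary_edge.
    (* For [p] at least 2 a face of codimension [p.+1] would exceed the codimension [d <= 2], so
       there is no generator to treat. *)
    have /codim : @open_faces _ _ X p.+1 !=set0 by exists (val f);
      exact: set_valP.
    by rewrite leqNgt ltnS (leq_trans d2 p1).
  exact: homology_embeds_in_free qB qker.
by split; apply/embeds_free_abelian/dirsum_embeds_in_free => p; exact: H.
Qed.
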